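(* For $n=0,1,2,\ldots$ let $R_n=\sum_{k=0}^n\binom{n}{k}\binom{n+k}{k}\frac{1}{2k-1}$. Then the sequence $\{R_{n+1}/R_n\}_{n\geq 3}$ is strictly increasing with limit $3+2\sqrt{2}$, and the sequence $\{\sqrt[n+1]{R_{n+1}}/\sqrt[n]{R_n}\}_{n\geq 5}$ is strictly decreasing with limit $1$.
   Context: The paper states this as ''Conjecture 1.2 (of Z.-W. Sun) is true''; the claim above is the content of that conjecture. *)

(* Defs.v *)
From HB Require Import structures.
From mathcomp Require Import all_boot all_order all_algebra.
From mathcomp Require Import all_classical all_reals all_analysis.
Set Implicit Arguments. Unset Strict Implicit. Unset Printing Implicit Defensive.
Import Order.TTheory GRing.Theory Num.Theory.
Local Open Scope ring_scope.

Definition Rn {R : realType} (n : nat) : R :=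
  \sum_(k < n.+1) ('C(n, k)%:R * 'C(n + k, k)%:R / (2 * k%:R - 1)).

Definition Rratio {R : realType} (n : nat) : R := @Rn R n.+1 / @Rn R n.

Definition Rroot {R : realType} (n : nat) : R := powR (@Rn R n) (n%:R)^-1.

Definition Rrootratio {R : realType} (n : nat) : R := @Rroot R n.+1 / @Rroot R n.

(* Main.v *)
(** [R_n] satisfies a recurrence of order three with coefficients linear in [n],
    obtained by creative telescoping. Writing [q_n = R_(n+1) / R_n], the increments
    [d_n = q_(n+1) - q_n] therefore satisfy
    [d_(n+2) = s_n / ((n + 3) (n + 4)) + a_n d_(n+1) - b_n d_n] with [6 <= s_n < 9] and
    small positive [a_n], [b_n] for [n >= 8], so that [0 < d_n <= 12 / (n (n + 1))]
    propagates by induction. Hence [q] increases; it is bounded, and passing to the limit in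
    the recurrence gives [(l - 1) (l^2 - 6 l + 1) = 0].
    Taking logarithms, the monotonicity of the root ratios amounts to
    [2 ln R_(n+1) + n (n + 1) ln (q_(n+1) / q_n) < 2 (n + 1) ln q_n]. The middle term
    is at most [3] for [n >= 6] by the bound on [d_n], and [2 ln R_(n+1) + 3 < 2 (n + 1) ln q_n]
    propagates because passing from [n] to [n + 1] adds [2 ln q_(n+1)] to the left
    side and at least as much to the right side, [q] being increasing. The case [n = 5]
    is numerical. *)
Require Import Defs.
From HB Require Import structures.
From mathcomp Require Import all_boot all_order all_algebra.
From mathcomp Require Import all_classical all_reals all_analysis.
From mathcomp Require Import ring lra zify.
Import Order.TTheory GRing.Theory Num.Theory.
Local Open Scope classical_set_scope.
Local Open Scope ring_scope.

(** * Order-three recurrence by creative telescoping *)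

Definition delannoy_term {R : realType} (n k : nat) : R := 'C(n, k)%:R * 'C(n + k, k)%:R.

Lemma delannoy_term_small {R : realType} (n k : nat) : (n < k)%N -> delannoy_term n k = 0 :> R.
Proof. by move=> nk; rewrite /delannoy_term bin_small// mul0r. Qed.

(* Solving for the smaller index keeps the denominators positive for all [k],
   including [k > n], where both sides vanish. *)
Lemma delannoy_term_down {R : realType} (n k : nat) :
  delannoy_term n k = (n%:R + 1 - k%:R) / (n%:R + 1 + k%:R) * delannoy_term n.+1 k :> R.
Proof.
have := mul_bin_down n.+1 k; have := mul_bin_down (n.+1 + k) k.
rewrite addSn /= subSn ?leq_addl// addnK => /(congr1 (fun m => m%:R : R)) h1.
move=> /(congr1 (fun m => m%:R : R)) h2.
have [kn|nk] := leqP k n.+1; last first.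
  by rewrite !delannoy_term_small ?mulr0// ltnW.
move: h1 h2; rewrite !natrM (natrB _ kn) /delannoy_term addSn -!natr1 natrD => h1 h2.
have p1 : n%:R + 1 + k%:R != 0 :> R by rewrite natr1 -natrD pnatr_eq0; lia.
have p2 : n%:R + 1 != 0 :> R by rewrite natr1 pnatr_eq0.
have e2 : 'C(n, k)%:R = (n%:R + 1 - k%:R) / (n%:R + 1) * 'C(n.+1, k)%:R :> R.
  by apply: (mulfI p2); rewrite h2; field.
have e1 : 'C(n + k, k)%:R = (n%:R + 1) / (n%:R + 1 + k%:R) * 'C((n + k).+1, k)%:R :> R.
  by apply: (mulfI p1); rewrite {1}(addrAC _ 1) h1; field.
by rewrite e1 e2; field; apply/andP.
Qed.

Lemma delannoy_term_next {R : realType} (n k : nat) :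
  delannoy_term n k.+1 = (n%:R - k%:R) * (n%:R + k%:R + 1) / (k%:R + 1) ^+ 2
    * delannoy_term n k :> R.
Proof.
have [kn|nk] := leqP k n; last first.
  by rewrite !delannoy_term_small ?mulr0// ltnW.
have p2 : k%:R + 1 != 0 :> R by rewrite natr1 pnatr_eq0.
have := mul_bin_left n k; have := mul_bin_diag (n + k).+1 k.
move=> /(congr1 (fun m => m%:R : R)) h1 /(congr1 (fun m => m%:R : R)) h2.
move: h1 h2; rewrite !natrM (natrB _ kn) /delannoy_term addnS -!natr1 natrD => h1 h2.
have -> : 'C((n + k).+1, k.+1)%:R = (n%:R + k%:R + 1) / (k%:R + 1) * 'C(n + k, k)%:R :> R.
  by apply: (mulfI p2); rewrite -h1 /=; field.
have -> : 'C(n, k.+1)%:R = (n%:R - k%:R) / (k%:R + 1) * 'C(n, k)%:R :> R.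
  by apply: (mulfI p2); rewrite h2; field.
by field.
Qed.

(** Puts consecutive values of [Rn] over one range of summation, so that the recurrence can be
    checked summand by summand. *)
Lemma Rn_widen {R : realType} (n m : nat) : (n < m)%N ->
  Rn n = \sum_(0 <= k < m) delannoy_term n k / (2 * k%:R - 1) :> R.
Proof.
move=> nm; rewrite /Rn -(big_mkord xpredT (fun k => delannoy_term n k / (2 * k%:R - 1))).
rewrite (big_cat_nat _ nm)//= [X in _ + X]big_nat_cond [X in _ + X]big1 ?addr0// => k.
by rewrite andbT => /andP[nk _]; rewrite delannoy_term_small// mul0r.
Qed.

Lemma two_mul_sub1_neq0 {R : realType} (k : nat) : 2 * k%:R - 1 != 0 :> R.
Proof.
rewrite subr_eq0 -[2]/(2%:R) -natrM -[1]/(1%:R) eqr_nat; lia.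
Qed.

Lemma Rn_rec {R : realType} (n : nat) :
  (n%:R + 3) * Rn n.+3 =
  (7 * n%:R + 13) * Rn n.+2 - (7 * n%:R + 15) * Rn n.+1 + (n%:R + 1) * Rn n :> R.
Proof.
(* [G] is the certificate found by Zeilberger's algorithm. *)
pose G k : R := 4 * (n%:R + 2) * k%:R ^+ 2 * delannoy_term n.+3 k /
  ((n%:R + 1 + k%:R) * (n%:R + 2 + k%:R) * (n%:R + 3 + k%:R)).
have step k : (n%:R + 1) * (delannoy_term n k / (2 * k%:R - 1))
    - (7 * n%:R + 15) * (delannoy_term n.+1 k / (2 * k%:R - 1))
    + (7 * n%:R + 13) * (delannoy_term n.+2 k / (2 * k%:R - 1))
    - (n%:R + 3) * (delannoy_term n.+3 k / (2 * k%:R - 1)) = G k.+1 - G k.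
  (* Everything becomes a rational multiple of [delannoy_term n.+3 k], which leaves an identity of
     rational functions. *)
  rewrite /G delannoy_term_next (delannoy_term_down n) (delannoy_term_down n.+1).
  rewrite (delannoy_term_down n.+2) -!natr1.
  have h0 : k%:R + 1 != 0 :> R by rewrite natr1 pnatr_eq0.
  have hk := two_mul_sub1_neq0 (R := R) k.
  have p (j i : nat) : (0 < j)%N -> n%:R + j%:R + i%:R != 0 :> R.
    by move=> j0; rewrite -!natrD pnatr_eq0; lia.
  field; rewrite h0 hk (p 1%N)// (p 2%N)// (p 3%N)//.
  by rewrite natr1 (p 3%N).
have := telescope_sumr G (leq0n n.+4).
under eq_bigr => k _ do rewrite -step.
rewrite !(big_split, sumrB, sumrN) /= -!mulr_sumr.
rewrite -!Rn_widen; try lia.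
(* [G] vanishes at 0 through its factor k^2 and at n + 4 through the binomial. *)
rewrite /G delannoy_term_small// expr0n /= !mulr0 !mul0r subr0 => h.
by apply/eqP; rewrite -subr_eq0 -oppr_eq0; apply/eqP; rewrite -[RHS]h; ring.
Qed.

(** * Positivity and the recurrence for the ratios *)

Lemma Rn_ge1 {R : realType} (n : nat) : (0 < n)%N -> 1 <= Rn n :> R.
Proof.
(* Only the term k = 0 is negative, with value -1; the term k = 1 is at least 2. *)
case: n => // n _; rewrite /Rn !big_ord_recl.
rewrite !lift0 /= !bin0 !bin1 mul1r mulr0 sub0r invrN1 mulr1.
rewrite addrA -[X in X <= _]addr0 lerD//.
  have : 0 <= n%:R :> R by [].
  have e : n.+1%:R = n%:R + 1 :> R by rewrite natr1.
  rewrite natrD e (_ : 2 - 1 = 1 :> R) ?divr1; last by ring.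
  by move=> n0; nra.
apply: sumr_ge0 => k _; rewrite /bump !add1n mulr_ge0 ?mulr_ge0// invr_ge0 subr_ge0.
Qed.

Lemma Rn_gt0 {R : realType} (n : nat) : (0 < n)%N -> 0 < Rn n :> R.
Proof. by move=> n0; apply: lt_le_trans (Rn_ge1 _ n0). Qed.

Lemma Rratio_gt0 {R : realType} (n : nat) : (0 < n)%N -> 0 < Rratio n :> R.
Proof. by move=> n0; rewrite divr_gt0 ?Rn_gt0. Qed.

(** This is [Rn_rec] divided by (n + 3) R_(n+2), with each coefficient split into its limit and a
    multiple of 1/(n + 3). *)
Lemma Rratio_rec {R : realType} (n : nat) : (0 < n)%N ->
  Rratio n.+2 = 7 - 8 / (n%:R + 3) - (7 - 6 / (n%:R + 3)) / Rratio n.+1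
    + (1 - 2 / (n%:R + 3)) / (Rratio n * Rratio n.+1) :> R.
Proof.
move=> n0; have h := Rn_rec (R := R) n.
have n3 : n%:R + 3 != 0 :> R by rewrite -natrD pnatr_eq0; lia.
have := Rn_gt0 (R := R) n n0; have := Rn_gt0 (R := R) n.+1 isT; have := Rn_gt0 (R := R) n.+2 isT.
move=> /lt0r_neq0 h2 /lt0r_neq0 h1 /lt0r_neq0 h0.
rewrite /Rratio; have -> : Rn n.+3 = ((n%:R + 3) * Rn n.+3) / (n%:R + 3) :> R by field.
by rewrite h; field; rewrite n3 h0 h1 h2.
Qed.

(** Two instances of [Rratio_rec] are subtracted. The first summand collects the change of the
    coefficients, through 1/(n+3) - 1/(n+4); the second collects the change of the ratios. *)
Lemma Rratio_diff {R : realType} (n : nat) : (0 < n)%N ->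
  Rratio n.+3 - Rratio n.+2 =
   (8 - 6 / Rratio n.+1 + 2 / (Rratio n * Rratio n.+1)) / ((n%:R + 3) * (n%:R + 4))
   + ((7 - 6 / (n%:R + 4)) * (Rratio n.+2 - Rratio n.+1)
      - (1 - 2 / (n%:R + 4)) * (Rratio n.+2 - Rratio n.+1 + (Rratio n.+1 - Rratio n)) / Rratio n)
     / (Rratio n.+1 * Rratio n.+2) :> R.
Proof.
move=> n0; rewrite (Rratio_rec n.+1)// [X in _ - X = _](Rratio_rec n)//.
have n3 : n%:R + 3 != 0 :> R by rewrite -natrD pnatr_eq0; lia.
have n4 : n%:R + 4 != 0 :> R by rewrite -natrD pnatr_eq0; lia.
have := Rratio_gt0 (R := R) n n0; have := Rratio_gt0 (R := R) n.+1 isT.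
have := Rratio_gt0 (R := R) n.+2 isT.
move=> /lt0r_neq0 h2 /lt0r_neq0 h1 /lt0r_neq0 h0.
have -> : n.+1%:R + 3 = n%:R + 4 :> R by rewrite -[n.+1]addn1 natrD; ring.
by field; rewrite n3 n4 h0 h1 h2.
Qed.

(** * Initial values and bounds on the increments *)

Lemma Rn_values_le2 {R : realType} : [/\ Rn 0 = -1 :> R, Rn 1 = 1 :> R & Rn 2 = 7 :> R].
Proof.
have b31 : 'C(2 + 1, 1) = 3%N by [].
have b42 : 'C(2 + 2, 2) = 6%N by [].
have e0 : (2 * 0%:R - 1)^-1 = -1 :> R by rewrite mulr0 sub0r invrN1.
have e1 : (2 * 1%:R - 1)^-1 = 1 :> R by rewrite -[RHS]invr1; congr (_^-1); ring.
have e2 : (2 * 2%:R - 1)^-1 = 1 / 3 :> R by rewrite div1r; congr (_^-1); ring.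
split; rewrite /Rn !big_ord_recl big_ord0 /= /bump /= ?add1n;
  rewrite ?b31 ?b42 ?bin0 ?bin1 ?binn ?e0 ?e1 ?e2; lra.
Qed.

(* Values are split at the thousands: long unary [nat] literals overflow the stack. *)
Lemma Rn_values_ge3 {R : realType} :
  (Rn 3 = 25 :> R) /\ (Rn 4 = 87 :> R) /\ (Rn 5 = 329 :> R) /\ (Rn 6 = 1359 :> R) /\
  (Rn 7 = 6 * 1000 + 1 :> R) /\ (Rn 8 = 27 * 1000 + 759 :> R) /\ (Rn 9 = 132 * 1000 + 689 :> R) /\
  (Rn 10 = 649 * 1000 + 815 :> R) /\ (Rn 11 = 3242 * 1000 + 377 :> R).
Proof.
have [h0 h1 h2] := @Rn_values_le2 R.
have h3 : Rn 3 = 25 :> R by have := @Rn_rec R 0; lra.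
have h4 : Rn 4 = 87 :> R by have := @Rn_rec R 1; lra.
have h5 : Rn 5 = 329 :> R by have := @Rn_rec R 2; lra.
have h6 : Rn 6 = 1359 :> R by have := @Rn_rec R 3; lra.
have h7 : Rn 7 = 6 * 1000 + 1 :> R by have := @Rn_rec R 4; lra.
have h8 : Rn 8 = 27 * 1000 + 759 :> R by have := @Rn_rec R 5; lra.
have h9 : Rn 9 = 132 * 1000 + 689 :> R by have := @Rn_rec R 6; lra.
have h10 : Rn 10 = 649 * 1000 + 815 :> R by have := @Rn_rec R 7; lra.
have h11 : Rn 11 = 3242 * 1000 + 377 :> R by have := @Rn_rec R 8; lra.
by do !split.
Qed.

(** The constant c = 12 reproduces itself in the induction because 81/10 + 7c/22 < c; divided by the
    bound 4 on the ratios, it later yields the constant 3. *)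
Definition Rratio_diff_bound {R : realType} (n : nat) : bool :=
  0 < (Rratio n.+1 - Rratio n : R) <= 12 / (n%:R * (n%:R + 1)).

Lemma Rratio_diff_bound_of_values {R : realType} (n : nat) : (0 < n)%N ->
  Rn n.+1 ^+ 2 < Rn n.+2 * Rn n :> R ->
  (Rn n.+2 * Rn n - Rn n.+1 ^+ 2) * (n%:R * (n%:R + 1)) <= 12 * (Rn n * Rn n.+1) :> R ->
  @Rratio_diff_bound R n.
Proof.
move=> n0 h1 h2; rewrite /Rratio_diff_bound /Rratio.
have p0 := Rn_gt0 (R := R) n n0; have p1 := Rn_gt0 (R := R) n.+1 isT.
have x0 : 0 < n%:R :> R by rewrite ltr0n.
have -> : Rn n.+2 / Rn n.+1 - Rn n.+1 / Rn n =
  (Rn n.+2 * Rn n - Rn n.+1 ^+ 2) / (Rn n * Rn n.+1) :> R.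
  by field; rewrite !lt0r_neq0.
rewrite divr_gt0 ?mulr_gt0 ?subr_gt0//= ler_pdivrMr ?mulr_gt0//.
by rewrite mulrAC ler_pdivlMr// mulr_gt0// addr_gt0.
Qed.

Lemma Rratio_diff_bound_small {R : realType} (n : nat) : (3 <= n <= 9)%N -> @Rratio_diff_bound R n.
Proof.
have [h3 [h4 [h5 [h6 [h7 [h8 [h9 [h10 h11]]]]]]]] := @Rn_values_ge3 R.
move=> /andP[n3 n9]; apply: Rratio_diff_bound_of_values; first by lia.
  by move: n n3 n9; case=> [|[|[|[|[|[|[|[|[|[|n]]]]]]]]]] //= _ _;
    rewrite ?h3 ?h4 ?h5 ?h6 ?h7 ?h8 ?h9 ?h10 ?h11; lra.
by move: n n3 n9; case=> [|[|[|[|[|[|[|[|[|[|n]]]]]]]]]] //= _ _;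
    rewrite ?h3 ?h4 ?h5 ?h6 ?h7 ?h8 ?h9 ?h10 ?h11; lra.
Qed.

Lemma Rratio_diff_bound_step {R : realType} (n : nat) : (8 <= n)%N ->
  239 / 50 <= Rratio n :> R -> @Rratio_diff_bound R n -> @Rratio_diff_bound R n.+1 ->
  @Rratio_diff_bound R n.+2.
Proof.
rewrite /Rratio_diff_bound => n8 q0_ge /andP[d0_gt0 d0_le] /andP[d1_gt0 d1_le].
rewrite Rratio_diff; last by lia.
have -> : n.+2%:R = n%:R + 2 :> R by rewrite -[n.+2]addn2 natrD.
have e1 : n.+1%:R = n%:R + 1 :> R by rewrite -natr1.
rewrite e1 in d1_le.
have x8 : 8 <= n%:R :> R by rewrite ler_nat.
move: (n%:R) (Rratio n) (Rratio n.+1) (Rratio n.+2) x8 q0_ge d0_gt0 d0_le d1_gt0 d1_le.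
move=> x q0 q1 q2 {e1 n n8} x8 q0_ge d0_gt0 d0_le d1_gt0 d1_le.
set S := 8 - _ + _; set E := (7 - _) * _ - _.
have B_gt0 : 0 < (q1 * q2)^-1 by rewrite invr_gt0; nra.
(* Both ratios are at least 239/50, whose square exceeds 22. *)
have B_le : (q1 * q2)^-1 <= 1 / 22.
  rewrite div1r lef_pV2 ?posrE; nra.
have S_bd : 6 <= S <= 81 / 10.
  have h1 : 0 < 6 / q1 by rewrite divr_gt0; lra.
  have h2 : 6 / q1 <= 2 by rewrite ler_pdivrMr; lra.
  have h3 : 0 < 2 / (q0 * q1) by rewrite divr_gt0//; nra.
  have h4 : 2 / (q0 * q1) <= 1 / 10 by rewrite ler_pdivrMr; nra.
  by rewrite /S; lra.
have E_bd : - ((q1 - q0) / 4) <= E <= 7 * (q2 - q1).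
  have h1 : 0 < 6 / (x + 4) <= 1 by rewrite divr_gt0 ?ler_pdivrMr; lra.
  have h2 : 0 < 2 / (x + 4) <= 1 by rewrite divr_gt0 ?ler_pdivrMr; lra.
  have h3 : 0 < q0^-1 <= 1 / 4 by rewrite invr_gt0 div1r lef_pV2 ?posrE; lra.
  have h4 : 0 <= (1 - 2 / (x + 4)) / q0 <= 1 / 4 by nra.
  have -> : E = (7 - 6 / (x + 4)) * (q2 - q1) - (1 - 2 / (x + 4)) / q0 * (q2 - q1 + (q1 - q0)).
    by rewrite /E; ring.
  move: ((1 - 2 / (x + 4)) / q0) (6 / (x + 4)) h1 h4 => u v h1 h4.
  by apply/andP; split; nra.
have pA : 0 < ((x + 3) * (x + 4))^-1 by rewrite invr_gt0; nra.
(* Serves positivity: the negative part is at most d0/88, hence at most 48/88 times 1/((x+3)(x+4)),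
   against the main term with factor 6. *)
have dA : (x * (x + 1))^-1 <= 4 / ((x + 3) * (x + 4)).
  by rewrite ler_pdivlMr ?[_^-1 * _]mulrC ?ler_pdivrMr; nra.
(* Serves the upper bound; 42/11 is 12 * 7/22. *)
have key : 81 / 10 / ((x + 3) * (x + 4)) + 42 / 11 / ((x + 1) * (x + 2)) <=
    12 / ((x + 2) * (x + 3)).
  rewrite -subr_ge0.
  have -> : 12 / ((x + 2) * (x + 3)) -
      (81 / 10 / ((x + 3) * (x + 4)) + 42 / 11 / ((x + 1) * (x + 2))) =
    (12 * (x + 1) * (x + 4) - 81 / 10 * (x + 1) * (x + 2)
      - 42 / 11 * (x + 3) * (x + 4)) / ((x + 1) * (x + 2) * (x + 3) * (x + 4)).
    field; rewrite !lt0r_neq0//; lra.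
  by apply: divr_ge0; [nra | rewrite !mulr_ge0; lra].
have e2 : x + 1 + 1 = x + 2 by ring.
have e3 : x + 2 + 1 = x + 3 by ring.
rewrite e2 in d1_le; rewrite e3.
move: (S) (E) (q1 * q2)^-1 ((x + 3) * (x + 4))^-1 (x * (x + 1))^-1
  ((x + 1) * (x + 2))^-1 ((x + 2) * (x + 3))^-1 B_gt0 B_le S_bd E_bd pA dA key d0_le d1_le.
clear -d0_gt0 d1_gt0; move: (q1 - q0) (q2 - q1) d0_gt0 d1_gt0.
move=> d0 d1 d0_gt0 d1_gt0 {}S {}E B A D C F.
move=> B_gt0 B_le /andP[S1 S2] /andP[E1 E2] pA dA key d0_le d1_le.
have SA1 : 6 * A <= S * A by nra.
have SA2 : S * A <= 81 / 10 * A by nra.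
have EB1 : - (d0 / 4) * (1 / 22) <= E * B by nra.
have EB2 : E * B <= 7 * d1 * (1 / 22) by nra.
by apply/andP; split; lra.
Qed.

(** The step looks back at two increments, so two consecutive bounds are carried. The number 239/50
    lies just below q_8 = 132689/27759 and remains a lower bound as q increases. *)
Lemma Rratio_diff_bound_ge8 {R : realType} (n : nat) : (8 <= n)%N ->
  [/\ 239 / 50 <= Rratio n :> R, @Rratio_diff_bound R n & @Rratio_diff_bound R n.+1].
Proof.
move=> /subnK <-; elim: (n - 8)%N => [|m [q8 d0 d1]].
  rewrite add0n; split; try exact: Rratio_diff_bound_small.
  have [h3 [h4 [h5 [h6 [h7 [h8 [h9 [h10 h11]]]]]]]] := @Rn_values_ge3 R.
  by rewrite /Rratio ler_pdivlMr h8 ?h9; lra.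
rewrite addSn; split => //.
  by move: d0 => /andP[+ _]; lra.
by apply: Rratio_diff_bound_step => //; lia.
Qed.

Lemma Rratio_diff_boundP {R : realType} (n : nat) : (3 <= n)%N -> @Rratio_diff_bound R n.
Proof.
have [n8 _|n8 n3] := leqP 8 n; first by have [] := @Rratio_diff_bound_ge8 R _ n8.
by apply: Rratio_diff_bound_small; lia.
Qed.

Lemma Rratio_incr {R : realType} (n : nat) : (3 <= n)%N -> Rratio n < Rratio n.+1 :> R.
Proof. by move=> /(@Rratio_diff_boundP R)/andP[+ _]; rewrite subr_gt0. Qed.

Lemma Rratio_ge4 {R : realType} (n : nat) : (6 <= n)%N -> 4 <= Rratio n :> R.
Proof.
have [h3 [h4 [h5 [h6 [h7 [h8 _]]]]]] := @Rn_values_ge3 R.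
move=> n6; have [n8|n8] := leqP 8 n.
  by have [] := @Rratio_diff_bound_ge8 R n n8; lra.
have : n = 6%N \/ n = 7%N by lia.
by move=> [] ->; rewrite /Rratio ler_pdivlMr ?h6 ?h7 ?h8; lra.
Qed.

Lemma Rratio_le8 {R : realType} (n : nat) : (6 <= n)%N -> Rratio n <= 8 :> R.
Proof.
(* Bounding q_(n+2) instead allows the recurrence to be used: it gives at most 7 + 1/16. *)
move=> n6; apply: (@le_trans _ _ (Rratio n.+2)).
  by apply: ltW; apply: lt_trans (Rratio_incr _ _) (Rratio_incr _ _); lia.
have h0 := Rratio_ge4 (R := R) _ n6; have h1 := Rratio_ge4 (R := R) _ (leqW n6).
have x0 : 0 <= n%:R :> R by [].
have a0 : 0 < (n%:R + 3 : R)^-1 <= 1 / 3 by rewrite invr_gt0 div1r lef_pV2 ?posrE; lra.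
have a1 : 0 < (Rratio n.+1 : R)^-1 <= 1 / 4 by rewrite invr_gt0 div1r lef_pV2 ?posrE; lra.
have a2 : 0 < (Rratio n * Rratio n.+1 : R)^-1 <= 1 / 16.
  by rewrite invr_gt0 div1r lef_pV2 ?posrE; nra.
by rewrite Rratio_rec; [nra|lia].
Qed.

(** * Limit of the ratios *)

Section RatioLimit.
Import numFieldNormedType.Exports.

Lemma Rratio_cvg {R : realType} : (@Rratio R) @ \oo --> 3 + 2 * Num.sqrt (2 : R).
Proof.
(* After the shift, the bounds 4 and 8 and the monotonicity hold from index 0. *)
rewrite -(cvg_shiftn 6 (@Rratio R : R^nat)).
set q : R^nat := [sequence _]_n.
have q_ge4 n : 4 <= q n by rewrite /q /= Rratio_ge4// leq_addl.
have q_nd : {homo q : n m / (n <= m)%N >-> n <= m}.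
  apply/nondecreasing_seqP => n; rewrite /q /= addSn ltW// Rratio_incr//; lia.
have q_rec n : q n.+2 = 7 - 8 / (n%:R + 9) - (7 - 6 / (n%:R + 9)) / q n.+1
    + (1 - 2 / (n%:R + 9)) / (q n * q n.+1).
  rewrite /q /= !addSn Rratio_rec; last by lia.
  by have -> : (n + 6)%:R + 3 = n%:R + 9 :> R by rewrite natrD; ring.
have q_bd : has_ubound (range q).
  by exists 8 => _ [n _ <-]; rewrite /q /= Rratio_le8// leq_addl.
have q_cvg := nondecreasing_is_cvgn q_nd q_bd.
set l := limn q in q_cvg *.
have l_ge4 : 4 <= l by apply: limr_ge => //; exact: nearW.
have cl : q n @[n --> \oo] --> l by [].
have cl1 : q n.+1 @[n --> \oo] --> l by rewrite (cvg_shiftS q).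
have cl2 : q n.+2 @[n --> \oo] --> l by rewrite (cvg_shiftS (fun n => q n.+1)).
have ch (c : R) : c / (n%:R + 9) @[n --> \oo] --> (0 : R).
  rewrite -[X in _ --> X](mulr0 c); apply: cvgM; first exact: cvg_cst.
  (* [harmonic] at n is 1/(n + 1), hence the shift by 8. *)
  have := @cvg_harmonic R; rewrite -(cvg_shiftn 8).
  apply: cvg_trans; apply: near_eq_cvg; apply: nearW => n /=.
  by rewrite -natr1 natrD -addrA; congr (_ + _)^-1; ring.
have l_neq0 : l != 0 by rewrite gt_eqF; lra.
have : q n.+2 @[n --> \oo] --> 7 - 0 - (7 - 0) / l + (1 - 0) / (l * l).
  rewrite (_ : (fun n => q n.+2) = (fun n : nat =>
      7 - 8 / (n%:R + 9) - (7 - 6 / (n%:R + 9)) / q n.+1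
    + (1 - 2 / (n%:R + 9)) / (q n * q n.+1))); last by apply/funext.
  apply: cvgD; first apply: cvgB.
  - by apply: cvgB => //; exact: cvg_cst.
  - by apply: cvgM; [apply: cvgB => //; exact: cvg_cst|exact: cvgV].
  - apply: cvgM; [by apply: cvgB => //; exact: cvg_cst|].
    by apply: cvgV; [rewrite mulf_neq0|exact: cvgM].
move=> /(cvg_unique _ cl2) => /(_ (@norm_hausdorff _ _)) el.
have : (l - 1) * ((l - 3) ^+ 2 - 8) = 0.
  have -> : (l - 1) * ((l - 3) ^+ 2 - 8) =
    l ^+ 2 * (l - (7 - 0 - (7 - 0) / l + (1 - 0) / (l * l))) by field.
  by rewrite -el subrr mulr0.
(* The bound 4 <= l excludes the root 1 and fixes the sign of l - 3. *)
move=> /eqP; rewrite mulf_eq0 => /orP[/eqP|]; first by lra.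
rewrite subr_eq0 => /eqP l2.
have -> : 3 + 2 * Num.sqrt 2 = l; last exact: q_cvg.
have : Num.sqrt ((l - 3) ^+ 2) = l - 3 by rewrite sqrtr_sqr ger0_norm; lra.
rewrite l2 (_ : 8 = 2 ^+ 2 * 2); last by ring.
rewrite sqrtrM ?exprn_ge0// sqrtr_sqr ger0_norm//; lra.
Qed.

End RatioLimit.

(** * Monotonicity of the root ratios *)

Lemma ln3_ge1 {R : realType} : 1 <= ln (3 : R).
Proof.
(* Since 1/3 <= (7/8)^8, the tangent bound ln (1 + t) <= t at t = -1/8 suffices. *)
have e : ln (7 / 8 : R) <= - (1 / 8).
  have -> : (7 / 8 : R) = 1 + - (1 / 8) by field.
  by apply: le_ln1Dx; lra.
have : ln ((7 / 8 : R) ^+ 8) <= - 1 by rewrite lnXn; lra.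
have : ln ((1 / 3 : R)) <= ln ((7 / 8 : R) ^+ 8) by rewrite ler_ln ?posrE; lra.
by rewrite div1r lnV ?posrE; lra.
Qed.

Lemma ln_Rratio {R : realType} (n : nat) : (0 < n)%N ->
  ln (Rratio n : R) = ln (Rn n.+1) - ln (Rn n).
Proof. by move=> n0; rewrite /Rratio ln_div// posrE Rn_gt0. Qed.

Lemma ln_Rn_bound {R : realType} (n : nat) : (6 <= n)%N ->
  2 * ln (Rn n.+1 : R) + 3 < 2 * (n%:R + 1) * ln (Rratio n : R).
Proof.
move=> /subnK <-; elim: (n - 6)%N => [|m IH].
  have [_ [_ [_ [h6 [h7 _]]]]] := @Rn_values_ge3 R.
  rewrite add0n /Rratio h6 h7.
  (* Replacing 3 by ln 27 turns the case n = 6 into a comparison of two rationals. *)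
  apply: (@le_lt_trans _ _ (ln ((6 * 1000 + 1) ^+ 2 * 3 ^+ 3))).
    rewrite lnM ?posrE ?lnXn; try lra.
    by have := @ln3_ge1 R; lra.
  have -> : 2 * (6 + 1) * ln ((6 * 1000 + 1) / 1359) = ln (((6 * 1000 + 1) / 1359) ^+ 14) :> R.
    by rewrite lnXn; lra.
  by rewrite ltr_ln ?posrE; lra.
rewrite !addSn.
have e : ln (Rn (m + 6).+2) = ln (Rratio (m + 6).+1) + ln (Rn (m + 6).+1) :> R.
  by rewrite ln_Rratio// subrK.
have : ln (Rratio (m + 6) : R) < ln (Rratio (m + 6).+1).
  rewrite ltr_ln ?posrE ?Rratio_gt0//; last by lia.
  by apply: Rratio_incr; lia.
rewrite -natr1 e; move: IH.
have : 0 <= (m + 6)%:R :> R by [].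
by nra.
Qed.

Lemma ln_Rratio_step {R : realType} (n : nat) : (5 <= n)%N ->
  2 * ln (Rn n.+1 : R) + n%:R * (n%:R + 1) * (ln (Rratio n.+1) - ln (Rratio n))
    < 2 * (n%:R + 1) * ln (Rratio n).
Proof.
rewrite leq_eqVlt => /orP[/eqP <-|n6].
  have [_ [_ [h5 [h6 [h7 _]]]]] := @Rn_values_ge3 R.
  (* [ln_Rn_bound] would fail at n = 5. The claim there is 30 ln q_6 + 2 ln R_6 < 42 ln q_5; simple
     rationals close to q_6 and q_5 keep the powers manageable. *)
  have a1 : ln (Rratio 6 : R) <= ln (53 / 12).
    rewrite ler_ln ?posrE; [|exact: Rratio_gt0|lra].
    by rewrite /Rratio ler_pdivrMr h6 ?h7; lra.
  have a2 : ln (413 / 100) <= ln (Rratio 5 : R).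
    rewrite ler_ln ?posrE; [|lra|exact: Rratio_gt0].
    by rewrite /Rratio ler_pdivlMr h5 ?h6; lra.
  have : ln ((53 / 12) ^+ 30 * 1359 ^+ 2) < ln ((413 / 100 : R) ^+ 42).
    by rewrite ltr_ln ?posrE; lra.
  rewrite lnM ?posrE ?lnXn; try lra.
  by rewrite h6; lra.
apply: le_lt_trans (ln_Rn_bound _ n6); rewrite lerD2l.
have p0 := Rratio_gt0 (R := R) n (ltn_trans (isT : (0 < 5)%N) n6).
have p1 := Rratio_gt0 (R := R) n.+1 isT.
have q4 := Rratio_ge4 (R := R) _ n6.
have x6 : 6 <= n%:R :> R by rewrite ler_nat.
have /andP[_ d] := Rratio_diff_boundP (R := R) n (ltnW (ltnW (ltnW n6))).
rewrite -ln_div ?posrE// mulrC -ler_pdivlMr; last by nra.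
have -> : Rratio n.+1 / Rratio n = 1 + (Rratio n.+1 - Rratio n) / Rratio n :> R.
  by field; rewrite lt0r_neq0.
have i : Rratio n < Rratio n.+1 :> R by apply: Rratio_incr; lia.
(* With t = d_n / q_n, the bounds d_n <= 12/(n(n+1)) and q_n >= 4 give t <= 3/(n(n+1)). *)
apply: le_trans (le_ln1Dx _) _.
  by apply: (@lt_le_trans _ _ 0) => //; apply: divr_ge0; lra.
rewrite ler_pdivrMr//; apply: le_trans d _.
have : 0 <= (n%:R * (n%:R + 1))^-1 :> R by rewrite invr_ge0; nra.
by nra.
Qed.

Lemma RrootE {R : realType} (n : nat) : (0 < n)%N ->
  Rroot n = expR (ln (Rn n) / n%:R) :> R.
Proof. by move=> n0; rewrite /Rroot /powR gt_eqF ?Rn_gt0// mulrC. Qed.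

Lemma RrootratioE {R : realType} (n : nat) : (0 < n)%N ->
  Rrootratio n = expR (ln (Rn n.+1) / (n%:R + 1) - ln (Rn n) / n%:R) :> R.
Proof. by move=> n0; rewrite /Rrootratio !RrootE// expRB -natr1. Qed.

Lemma Rrootratio_decr {R : realType} (n : nat) : (5 <= n)%N ->
  Rrootratio n.+1 < Rrootratio n :> R.
Proof.
move=> n5; rewrite !RrootratioE ?ltr_expR; try lia.
have := @ln_Rratio_step R _ n5.
have -> : n.+1%:R = n%:R + 1 :> R by rewrite natr1.
rewrite !ln_Rratio; try lia.
have : 5 <= n%:R :> R by rewrite ler_nat.
move: (ln (Rn n)) (ln (Rn n.+1)) (ln (Rn n.+2)) (n%:R) => a b c x x5 h.
rewrite -subr_gt0.
(* The numerator is exactly the slack in [ln_Rratio_step]. *)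
have -> : b / (x + 1) - a / x - (c / (x + 1 + 1) - b / (x + 1)) =
  (2 * (x + 1) * (b - a) - (2 * b + x * (x + 1) * (c - b - (b - a)))) / (x * (x + 1) * (x + 2)).
  field; rewrite !lt0r_neq0//; lra.
by rewrite divr_gt0 ?subr_gt0// !mulr_gt0//; lra.
Qed.

(** * Limit of the root ratios *)

Lemma ln_Rn_le {R : realType} (n : nat) : (6 <= n)%N -> ln (Rn n : R) <= n%:R * ln 8.
Proof.
move=> /subnK <-; elim: (n - 6)%N => [|m IH].
  have [_ [_ [_ [h6 _]]]] := @Rn_values_ge3 R.
  rewrite add0n h6 mulr_natl -lnXn ?ler_ln ?posrE; lra.
have : ln (Rratio (m + 6) : R) <= ln 8.
  rewrite ler_ln ?posrE ?Rratio_le8 ?leq_addl//.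
  by apply: Rratio_gt0; lia.
have -> : (m.+1 + 6)%:R = (m + 6)%:R + 1 :> R by rewrite natr1.
by rewrite ln_Rratio ?addSn; [lra|lia].
Qed.

(** The exponent equals (ln q_n - (ln R_n)/n) / (n + 1), a difference of two numbers in [0, ln 8]
    over n + 1. *)
Lemma Rrootratio_bound {R : realType} (n : nat) : (6 <= n)%N ->
  expR (- (ln 8 / n.+1%:R)) <= @Rrootratio R n <= expR (ln 8 / n.+1%:R).
Proof.
move=> n6; have n0 : (0 < n)%N by lia.
rewrite RrootratioE// !ler_expR.
have -> : n.+1%:R = n%:R + 1 :> R by rewrite natr1.
have x0 : 0 < n%:R :> R by rewrite ltr0n.
have -> : ln (Rn n.+1) / (n%:R + 1) - ln (Rn n) / n%:R =
  (ln (Rratio n) - ln (Rn n) / n%:R) / (n%:R + 1) :> R.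
  rewrite ln_Rratio//; field; rewrite !lt0r_neq0//; lra.
have a_le : ln (Rn n) / n%:R <= ln 8 :> R.
  by rewrite ler_pdivrMr// mulrC ln_Rn_le.
have a_ge : 0 <= ln (Rn n) / n%:R :> R by rewrite divr_ge0 ?ln_ge0 ?Rn_ge1.
have r_le : ln (Rratio n : R) <= ln 8.
  by rewrite ler_ln ?posrE ?Rratio_le8 ?Rratio_gt0.
have r_ge : 0 <= ln (Rratio n : R).
  by apply: ln_ge0; have := Rratio_ge4 (R := R) _ n6; lra.
by rewrite -mulNr !ler_pM2r ?invr_gt0 ?addr_gt0//; lra.
Qed.

Section RootRatioLimit.
Import numFieldNormedType.Exports.

Lemma Rrootratio_cvg {R : realType} : (@Rrootratio R) @ \oo --> (1 : R).
Proof.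
have h (c : R) : expR (c / n.+1%:R) @[n --> \oo] --> (1 : R).
  rewrite -[X in _ --> X]expR0; apply: continuous_cvg; first exact: continuous_expR.
  by rewrite -[X in _ --> X](mulr0 c); exact: (cvgM (cvg_cst c) (@cvg_harmonic R)).
apply: (squeeze_cvgr _ (h (- ln 8)) (h (ln 8))).
near=> n; rewrite mulNr; apply: Rrootratio_bound.
by near: n; exact: nbhs_infty_ge.
Unshelve. all: by end_near. Qed.

End RootRatioLimit.

Theorem theorem1p4 (R : realType) :
  [/\ (forall n : nat, (3 <= n)%N -> @Rratio R n < @Rratio R n.+1),
      (@Rratio R) @ \oo --> 3 + 2 * Num.sqrt (2 : R),
      (forall n : nat, (5 <= n)%N -> @Rrootratio R n.+1 < @Rrootratio R n)
    & ((@Rrootratio R) @ \oo --> (1 : R^o))].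
Proof.
split; [exact: Rratio_incr|exact: Rratio_cvg|exact: Rrootratio_decr|].
exact: Rrootratio_cvg.
Qed.
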